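(* Let $X$ be a weakly compactly generated (WCG) Banach space and let $\alpha$ be a countable ordinal. If $S_Z(X)>\alpha$, then there is a closed subspace $Y$ of $X$ such that the quotient $Z=X/Y$ is separable and satisfies $S_Z(Z)>\alpha$.
   Context: A Banach space $X$ is WCG if there is a weakly compact $K\subset X$ with $\overline{\mathrm{span}}(K)=X$. Szlenk index. For a weak$^*$-compact $K\subset X^*$ and $\varepsilon>0$, let $s_\varepsilon(K)$ be $K$ minus the union of all (relatively) weak$^*$-open subsets $V$ of $K$ with $\operatorname{diam}V\le\varepsilon$. Put $s^1_\varepsilon(K)=s_\varepsilon(K)$, $s^{\alpha+1}_\varepsilon(K)=s_\varepsilon(s^\alpha_\varepsilon(K))$, and $s^\alpha_\varepsilon(K)=\bigcap_{\beta<\alpha}s^\beta_\varepsilon(K)$ for limit $\alpha$. Let $S_Z(K,\varepsilon)$ be the least $\alpha$ with $s^\alpha_\varepsilon(K)=\emptyset$ if it exists and $\infty$ otherwise ($\infty$ is larger than every ordinal). The Szlenk index of $X$ is $S_Z(X)=\sup_{\varepsilon>0}S_Z(B_{X^*},\varepsilon)$, where $B_{X^*}$ is the closed unit ball of $X^*$. (The notation $S_Z$ for the index is unrelated to the name of the space $Z$.) *)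

(* Defs.v *)
From HB Require Import structures.
From mathcomp Require Import all_boot all_order all_algebra.
From mathcomp Require Import all_classical all_reals ereal topology normedtype.

Set Implicit Arguments.
Unset Strict Implicit.
Unset Printing Implicit Defensive.

Import Order.TTheory GRing.Theory Num.Theory.
Import numFieldNormedType.Exports.

Local Open Scope classical_set_scope.
Local Open Scope ring_scope.

(* [Osup f] is the least ordinal strictly above all the [f i]; every ordinal
   arises in this way from its predecessors.  Distinct trees may denote the same
   ordinal: equality of ordinals is [oeq]. *)
Inductive Ord : Type := Osup (A : Type) (f : A -> Ord).

Fixpoint ole (a b : Ord) {struct a} : Prop :=
  match a, b with
  | Osup A f, Osup B g => forall i, exists j, ole (f i) (g j)
  end.

Definition olt (a b : Ord) : Prop :=
  match b with Osup B g => exists j, ole a (g j) end.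

Definition oeq (a b : Ord) : Prop := ole a b /\ ole b a.

Definition ozero : Ord := Osup (fun e : Empty_set => match e with end).

Definition osucc (a : Ord) : Ord := Osup (fun _ : unit => a).

Definition olimit (a : Ord) : Prop :=
  olt ozero a /\ forall b, olt b a -> olt (osucc b) a.

Definition countable_ord (a : Ord) : Prop :=
  exists f : nat -> Ord, forall b, olt b a -> exists n, oeq b (f n).

Lemma ole_refl a : ole a a.
Proof. by elim: a => I f IH /= i; exists i. Qed.

Lemma ole_trans b a c : ole a b -> ole b c -> ole a c.
Proof.
elim: a b c => I f IH [J g] [K h] /= ab bc i.
have [j fg] := ab i; have [k gh] := bc j.
by exists k; exact: IH fg gh.
Qed.

Lemma oltW a b : olt a b -> ole a b.
Proof.
elim: a b => I f IH [J g] /= [j]; case E : (g j) => [K h] /= fh i.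
exists j; apply: IH; rewrite E /=; exact: fh.
Qed.

Lemma olt_le_trans b a c : olt a b -> ole b c -> olt a c.
Proof.
case: b c => [J g] [K h] /= [j aj] bc; have [k jk] := bc j.
by exists k; exact: ole_trans jk.
Qed.

Lemma ole_lt_trans b a c : ole a b -> olt b c -> olt a c.
Proof. by case: c => [K h] ab /= [k bk]; exists k; exact: ole_trans bk. Qed.

Lemma olt_sub I (f : I -> Ord) i : olt (f i) (Osup f).
Proof. by exists i; exact: ole_refl. Qed.

Lemma ole_ltP a b : ole a b <-> forall c, olt c a -> olt c b.
Proof.
split=> [ab c ca|]; first exact: olt_le_trans ab.
case: a b => [I f] [J g] H /= i; exact: (H _ (olt_sub f i)).
Qed.

Lemma olt_wf : well_founded olt.
Proof.
suff H a b : ole b a -> Acc olt b by move=> a; exact: (H a a (ole_refl a)).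
elim: a b => I f IH b ba; constructor => c cb.
by have [i ci] := olt_le_trans cb ba; exact: IH ci.
Qed.

Lemma olt_irr a : ~ olt a a.
Proof. by elim/(well_founded_ind olt_wf): a => a IH aa; exact: (IH _ aa aa). Qed.

Lemma oleNlt a b : ole a b <-> ~ olt b a.
Proof.
split=> [ab ba|]; first exact: (olt_irr (ole_lt_trans ab ba)).
elim: a b => I f IH [J g] /= nba i.
have /existsNP[j] : ~ (forall j, olt (g j) (f i)).
  move=> H; apply: nba; exists i; apply: (proj2 (ole_ltP (Osup g) (f i))) => c [j cj].
  exact: ole_lt_trans cj (H j).
by move=> /IH; exists j.
Qed.

Lemma olt_succ a b : olt b (osucc a) <-> ole b a.
Proof. by split=> [[]|ba] //; exists tt. Qed.

(** Ordinals extended by [None], standing for the infinity above every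
    ordinal. *)
Definition eOrd : Type := option Ord.

Definition eole (x y : eOrd) : Prop :=
  match x, y with
  | _, None => True
  | Some a, Some b => ole a b
  | None, Some _ => False
  end.

Definition eolt (x y : eOrd) : Prop :=
  match x, y with
  | Some a, Some b => olt a b
  | Some _, None => True
  | None, _ => False
  end.

Definition oleast (P : Ord -> Prop) (a : Ord) : Prop :=
  P a /\ forall b, P b -> ole a b.

(* The choice made here is only between trees denoting the same ordinal.
   Collections of ordinals are plain predicates: [set Ord] would bound the
   universe of [Ord] and keep carriers of normed spaces from indexing [Osup]. *)
Definition omin (P : Ord -> Prop) : eOrd :=
  if pselect (exists a, oleast P a) is left h then Some (projT1 (cid h))
  else None.

Definition eosup (A : eOrd -> Prop) : eOrd :=
  omin (fun b => forall x, A x -> eole x (Some b)).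

Lemma oleast_ex (P : Ord -> Prop) : (exists a, P a) -> exists a, oleast P a.
Proof.
move=> [a Pa]; apply: contrapT => /forallNP H.
elim/(well_founded_ind olt_wf): a Pa => a IH Pa; apply: (H a); split=> // b Pb.
by apply/oleNlt => ba; exact: (IH _ ba Pb).
Qed.

Lemma ominP (P : Ord -> Prop) :
  match omin P with Some a => oleast P a | None => forall a, ~ P a end.
Proof.
rewrite /omin; case: pselect => [h|nh]; first by case: (cid h).
by move=> a Pa; apply: nh; apply: oleast_ex; exists a.
Qed.

Section Dual.
Variables (R : realType) (X : normedModType R).

Record dual_space := Dual {
  dual_lin :> {linear X -> R^o};
  dual_continuous : continuous (dual_lin : X -> R^o) }.

HB.instance Definition _ := gen_eqMixin dual_space.
HB.instance Definition _ := gen_choiceMixin dual_space.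

Definition weak_star : Type :=
  initial_topology ((fun f : dual_space => f : X -> R^o) : dual_space -> {ptws X -> R^o}).
HB.instance Definition _ := Topological.on weak_star.

Definition weak : Type :=
  initial_topology
    ((fun (x : X) (f : dual_space) => f x : R^o) : X -> {ptws dual_space -> R^o}).
HB.instance Definition _ := Topological.on weak.

Definition opnorm (u : X -> R) : R := sup [set `|u x| | x in [set x | `|x| <= 1]].

Definition dual_ball : set weak_star := [set f : dual_space | opnorm f <= 1].

Definition dual_diam (V : set weak_star) : \bar R :=
  ereal_sup [set (opnorm (fun x => (p.1 : dual_space) x - (p.2 : dual_space) x))%:E
            | p in V `*` V].

Definition linear_span (K : set X) : set X :=
  [set x | exists n (c : 'I_n -> R) (v : 'I_n -> X),
    (forall i, K (v i)) /\ x = \sum_(i < n) c i *: v i].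

Definition WCG : Prop :=
  exists K : set X, compact (K : set weak) /\ closure (linear_span K) = [set: X].

Definition szlenk_derivation (e : R) (K : set weak_star) : set weak_star :=
  K `\` \bigcup_(V in [set V | (exists2 U : set weak_star, open U & V = K `&` U)
                            /\ (dual_diam V <= e%:E)%E]) V.

(* Uniform form of the transfinite recursion: the iterate at [a] is the
   intersection of the derivations of the iterates at the ordinals below [a];
   see [szlenk_iter0], [szlenk_iterS] and [szlenk_iter_lim] below for the usual
   clauses. *)
Fixpoint szlenk_iter (e : R) (K : set weak_star) (a : Ord) : set weak_star :=
  match a with
  | Osup A f =>
      K `&` \bigcap_(i in [set: A]) szlenk_derivation e (szlenk_iter e K (f i))
  end.

Definition szlenk_eps (K : set weak_star) (e : R) : eOrd :=
  omin (fun a => szlenk_iter e K a = set0).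

Definition szlenk : eOrd :=
  eosup (fun x => exists2 e : R, 0 < e & x = szlenk_eps dual_ball e).

Lemma szlenk_derivation_sub e K : szlenk_derivation e K `<=` K.
Proof. exact: subDsetl. Qed.

Lemma szlenk_derivationS e K L :
  K `<=` L -> szlenk_derivation e K `<=` szlenk_derivation e L.
Proof.
move=> KL f [Kf nf]; split; first exact: KL.
move=> [V [[U oU ->] dV] [_ Uf]]; apply: nf.
exists (K `&` U) => //; split; first by exists U.
apply: le_trans dV; apply: le_ereal_sup => _ [p [[Kp1 Up1] [Kp2 Up2]] <-].
by exists p => //; split; split=> //; exact: KL.
Qed.

Lemma szlenk_iter_sub e K a : szlenk_iter e K a `<=` K.
Proof. by case: a => I f x []. Qed.

Lemma szlenk_iter_le e K a b : ole a b -> szlenk_iter e K b `<=` szlenk_iter e K a.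
Proof.
elim: a b => I f IH [J g] ab x [Kx xg]; split=> // i _.
have [j fg] := ab i.
exact: (szlenk_derivationS (IH i _ fg) (xg j Logic.I)).
Qed.

Lemma szlenk_iter_oeq e K a b : oeq a b -> szlenk_iter e K a = szlenk_iter e K b.
Proof. by move=> [ab ba]; apply/seteqP; split; exact: szlenk_iter_le. Qed.

Lemma szlenk_iter0 e K : szlenk_iter e K ozero = K.
Proof. by apply/seteqP; split=> [x []|x Kx] //; split. Qed.

Lemma szlenk_iterS e K a :
  szlenk_iter e K (osucc a) = szlenk_derivation e (szlenk_iter e K a).
Proof.
apply/seteqP; split=> [x [_ /(_ tt)]|x xa]; first exact.
by split=> //; apply: szlenk_iter_sub (szlenk_derivation_sub xa).
Qed.

Lemma szlenk_iter_lim e K a : olimit a ->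
  szlenk_iter e K a = [set f | forall b, olt b a -> szlenk_iter e K b f].
Proof.
move=> [a0 aS]; apply/seteqP; split=> [x xa b /oltW ba|].
  exact: szlenk_iter_le xa.
case: a a0 aS => J f a0 aS x xf; split.
  exact: szlenk_iter_sub (xf _ a0).
by move=> i _; rewrite -szlenk_iterS; apply: xf; apply: aS; exact: olt_sub.
Qed.

End Dual.

Section Quotient.
Variables (R : realType) (X : normedModType R).

Record closed_subspace := ClosedSubspace {
  subspace_pred :> {pred X};
  subspace_submod : submod_closed subspace_pred;
  subspace_closed : closed [set` subspace_pred] }.

HB.instance Definition _ (Y : closed_subspace) :=
  GRing.isSubmodClosed.Build R X (subspace_pred Y) (subspace_submod Y).

Variable Y : closed_subspace.

Definition quotient_space : Type := Quotient.quot (subspace_pred Y).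

HB.instance Definition _ := GRing.Zmodule.on quotient_space.
HB.instance Definition _ := EqQuotient.on quotient_space.

Local Open Scope quotient_scope.

Definition quotient_pi (x : X) : quotient_space := \pi_quotient_space x.

Lemma quotient_piP x y : (quotient_pi x = quotient_pi y) <-> (x - y \in subspace_pred Y).
Proof.
rewrite /quotient_pi; split.
  by move/eqP; rewrite -Quotient.idealrBE.
by rewrite Quotient.idealrBE => /eqP.
Qed.

Lemma quotient_piK z : exists x, quotient_pi x = z.
Proof. by exists (repr z); rewrite /quotient_pi reprK. Qed.

Lemma quotient_piD x y : quotient_pi (x + y) = quotient_pi x + quotient_pi y.
Proof. by rewrite /quotient_pi !piE. Qed.

Lemma quotient_pi0 : quotient_pi 0 = 0.
Proof. by rewrite /quotient_pi !piE. Qed.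

Definition quotient_scale (a : R) (z : quotient_space) : quotient_space :=
  quotient_pi (a *: repr z).

Lemma quotient_piZ a x : quotient_scale a (quotient_pi x) = quotient_pi (a *: x).
Proof.
apply/quotient_piP; rewrite -scalerBr; apply: rpredZ.
by apply/quotient_piP; rewrite /quotient_pi reprK.
Qed.

Lemma quotient_scaleA a b z :
  quotient_scale a (quotient_scale b z) = quotient_scale (a * b) z.
Proof. by have [x <-] := quotient_piK z; rewrite !quotient_piZ scalerA. Qed.

Lemma quotient_scale1 : left_id 1 quotient_scale.
Proof. by move=> z; have [x <-] := quotient_piK z; rewrite quotient_piZ scale1r. Qed.

Lemma quotient_scaleDr : right_distributive quotient_scale +%R.
Proof.
move=> a z w; have [x <-] := quotient_piK z; have [y <-] := quotient_piK w.
by rewrite -quotient_piD !quotient_piZ -quotient_piD scalerDr.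
Qed.

Lemma quotient_scaleDl z : {morph quotient_scale^~ z : a b / a + b}.
Proof.
by move=> a b; have [x <-] := quotient_piK z; rewrite !quotient_piZ -quotient_piD scalerDl.
Qed.

HB.instance Definition _ := GRing.Zmodule_isLmodule.Build R quotient_space
  quotient_scaleA quotient_scale1 quotient_scaleDr quotient_scaleDl.

Definition quotient_norm (z : quotient_space) : R :=
  inf [set `|x| | x in [set x | quotient_pi x = z]].

Let norms_has_inf z : has_inf [set `|x| | x in [set x | quotient_pi x = z]].
Proof.
split; last by exists 0 => _ [x _ <-].
by have [x xz] := quotient_piK z; exists `|x|, x.
Qed.

Let norm_le x : quotient_norm (quotient_pi x) <= `|x|.
Proof. by apply: ge_inf; [exact: (norms_has_inf _).2|exists x]. Qed.

Let norm_lt z e : 0 < e -> exists2 x, quotient_pi x = z & `|x| < quotient_norm z + e.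
Proof.
move=> e0; have [_ [x xz <-]] := inf_adherent e0 (norms_has_inf z).
by exists x.
Qed.

Lemma quotient_normD z w : quotient_norm (z + w) <= quotient_norm z + quotient_norm w.
Proof.
apply/ler_addgt0Pr => e e0; have e2 : 0 < e / 2 by rewrite divr_gt0.
have [x <- xe] := norm_lt z e2; have [y <- ye] := norm_lt w e2.
rewrite -quotient_piD; apply: le_trans (norm_le _) _; apply: le_trans (ler_normD _ _) _.
by rewrite [e]splitr addrACA; apply: lerD; exact: ltW.
Qed.

Lemma quotient_normZ a z : quotient_norm (a *: z) = `|a| * quotient_norm z.
Proof.
have le b w : quotient_norm (b *: w) <= `|b| * quotient_norm w.
  apply/ler_addgt0Pr => e e0.
  have b1 : 0 < `|b| + 1 by rewrite ltr_wpDl.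
  have [x <- xe] := norm_lt w (divr_gt0 e0 b1).
  rewrite [b *: _]quotient_piZ; apply: le_trans (norm_le _) _; rewrite normrZ.
  apply: le_trans (ler_wpM2l (normr_ge0 _) (ltW xe)) _.
  rewrite mulrDr lerD2l mulrCA ler_piMr ?(ltW e0)//.
  by rewrite ler_pdivrMr// mul1r lerDl.
have [->|a0] := eqVneq a 0.
  apply/eqP; rewrite eq_le le scale0r normr0 mul0r.
  by apply: lb_le_inf => [|_ [x _ <-]//]; exact: (norms_has_inf _).1.
apply/eqP; rewrite eq_le le /= -ler_pdivlMl ?normr_gt0//.
by rewrite -normfV; apply: le_trans (le _ _); rewrite scalerA mulVf// scale1r.
Qed.

Lemma quotient_norm0_eq0 z : quotient_norm z = 0 -> z = 0.
Proof.
move=> z0; have [x xz] := quotient_piK z.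
rewrite -xz -quotient_pi0; apply/quotient_piP; rewrite subr0.
apply: (@subspace_closed Y) => /= B /nbhs_ballP[e /= e0 Be].
have [y yz ye] := norm_lt z e0; rewrite z0 add0r in ye.
exists (x - y); split; first by apply/quotient_piP; rewrite xz yz.
by apply: Be; rewrite -ball_normE /= opprB addrC subrK.
Qed.

HB.instance Definition _ := Lmodule_isNormed.Build R quotient_space
  quotient_normD quotient_normZ quotient_norm0_eq0.

End Quotient.

Definition separable (T : topologicalType) : Prop :=
  exists2 D : set T, countable D & dense D.

(* Main.v *)
From HB Require Import structures.
Require Import Defs.
From mathcomp Require Import all_boot all_order all_algebra.
From mathcomp Require Import all_classical all_reals ereal topology normedtype.
From mathcomp Require Import lra ring.

Set Implicit Arguments.
Unset Strict Implicit.
Unset Printing Implicit Defensive.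

Import Order.TTheory GRing.Theory Num.Theory.
Import numFieldNormedType.Exports.

Local Open Scope classical_set_scope.
Local Open Scope ring_scope.

(** The Szlenk derivation asks for weak* nets, but over a weakly compactly
    generated space it is witnessed by countably many functionals, and countably
    many functionals live on a separable quotient.

    Let K be weakly compact with dense span.  On the dual ball the weak* topology
    is pointwise convergence on K, and a space of continuous functions on a
    compact space is countably tight for pointwise convergence: for each n and k,
    finitely many functions suffice to approximate the limit within 1/(k+1) at
    every n-tuple of points of K, because the n-th power of K is compact
    ([compact_countably_tight]).  So if f survives the derivation of a set L, then
    countably many pairs of points of L, each pair more than e apart in norm,
    cluster at (f, f) ([pairs_cluster_countable]).  Survival of f is therefore
    inherited by any quotient X/Y for which Y is killed by f and by all
    members of these pairs: such functionals factor through X/Y, with the same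
    norm ([quotient_opnorm]) and the same clustering
    ([szlenk_derivation_countable]).  Iterating over the countably many ordinals
    below a countable ordinal collects a countable set A of functionals such
    that the iterate of order alpha of the dual ball of X/Y is nonempty as soon
    as A vanishes on Y ([szlenk_iter_countable]).

    It remains to see that X/Y is separable when Y is the set of common zeros of
    A ([separable_annihilator_quotient]).  For the topology generated by A, the
    set K has a countable dense subset D.  Given x in K, points of D that
    approach x for that topology have a weak cluster point e by weak
    compactness; A does not distinguish e from x, so e and x agree modulo Y,
    while e lies in the closed span of D by Hahn-Banach
    ([subspace_separation]).  Hence the image of the closed span of D contains
    the image of K, whose span is dense in X/Y. *)

(** * Hahn-Banach by minimal sublinear functionals *)

Section Sublinear.
Variables (R : realType) (V : lmodType R).
Implicit Types (p q r : V -> R) (x y : V).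

Definition sublinear q :=
  (forall x y, q (x + y) <= q x + q y) /\
  (forall t x, 0 < t -> q (t *: x) <= t * q x).

Lemma sublinear0 q : sublinear q -> q 0 = 0.
Proof.
move=> [qD qZ]; have := qD 0 0; rewrite addr0 => h1.
have := qZ 2^-1 0 ltac:(by rewrite invr_gt0); rewrite scaler0 => h2.
by apply/eqP; rewrite eq_le; apply/andP; split; lra.
Qed.

Lemma sublinearN q x : sublinear q -> - q (- x) <= q x.
Proof. by move=> q_sub; have := q_sub.1 x (- x); rewrite subrr sublinear0//; lra. Qed.

(** Pointwise infima are used twice below, over a chain of functionals and over
    translations along a half-line.  The last two conditions ask for one element of
    the family, since the elements given at x and at y need not come from the
    same member of the chain, or from the same translation. *)
Lemma inf_sublinear (F : V -> set R) :
  (forall x, F x !=set0) -> (forall x, has_lbound (F x)) ->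
  (forall x y a b, F x a -> F y b -> exists2 c, F (x + y) c & c <= a + b) ->
  (forall t x a, 0 < t -> F x a -> exists2 c, F (t *: x) c & c <= t * a) ->
  sublinear (fun x => inf (F x)).
Proof.
move=> F0 Fb FD FZ; split=> [x y|t x t0].
  rewrite -lerBlDr; apply: lb_le_inf => // a Fa.
  rewrite lerBlDl -lerBlDr; apply: lb_le_inf => // b Fb'.
  have [c Fc cab] := FD _ _ _ _ Fa Fb'.
  by rewrite lerBlDl (le_trans _ cab)//; exact: ge_inf.
rewrite -ler_pdivrMl//; apply: lb_le_inf => // a Fa.
have [c Fc cta] := FZ _ _ _ t0 Fa.
by rewrite ler_pdivrMl// (le_trans _ cta)//; exact: ge_inf.
Qed.

(** Zorn: all functionals of a chain below p are bounded below at x by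
    - p (- x), so their infimum is finite. *)
Lemma sublinear_minimal p : sublinear p ->
  exists q, [/\ sublinear q, forall x, q x <= p x &
    forall r, sublinear r -> (forall x, r x <= q x) -> r = q].
Proof.
move=> p_sub.
pose T := {q : V -> R | sublinear q /\ forall x, q x <= p x}.
pose below (s t : T) := `[< forall x, sval t x <= sval s x >].
have pp : sublinear p /\ forall x, p x <= p x by split.
have [|||[q [q_sub qp]] qmin] := @ZL_preorder T (exist _ p pp) below.
- by move=> t; exact/asboolP.
- move=> r s t /asboolP rs /asboolP st; apply/asboolP => x.
  exact: le_trans (st x) (rs x).
- move=> A Atot.
  have [A0|/set0P[s0 As0]] := eqVneq A set0.
    by exists (exist _ p pp) => s; rewrite A0.
  pose F x : set R := [set sval s x | s in A].
  have Fb x : has_lbound (F x).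
    exists (- p (- x)) => _ [s As <-].
    by have [s_sub sp] := svalP s; have := sublinearN x s_sub; have := sp (- x); lra.
  have m_sub : sublinear (fun x => inf (F x)).
    apply: inf_sublinear => //.
    - by move=> x; exists (sval s0 x), s0.
    - move=> x y _ _ [s As <-] [t At <-].
      have [s_sub _] := svalP s; have [t_sub _] := svalP t.
      have [/asboolP st|/asboolP ts] := Atot _ _ As At.
        exists (sval t (x + y)); first by exists t.
        by apply: le_trans (t_sub.1 _ _) _; rewrite lerD2r.
      exists (sval s (x + y)); first by exists s.
      by apply: le_trans (s_sub.1 _ _) _; rewrite lerD2l.
    - move=> t x _ t0 [s As <-]; exists (sval s (t *: x)); first by exists s.
      by have [s_sub _] := svalP s; exact: s_sub.2.
  have mp x : inf (F x) <= p x.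
    have [_ sp] := svalP s0; apply: le_trans (sp x).
    by apply: ge_inf => //; exists s0.
  exists (exist _ (fun x => inf (F x)) (conj m_sub mp)) => s As.
  by apply/asboolP => x; apply: ge_inf => //; exists s.
exists q; split=> // r r_sub rq.
have rp x : r x <= p x by exact: le_trans (rq x) (qp x).
have /asboolP qr : below (exist _ r (conj r_sub rp)) (exist _ q (conj q_sub qp)).
  by apply: qmin; exact/asboolP.
by apply/funext => x; apply/eqP; rewrite eq_le rq qr.
Qed.

(** The functional r x = inf over t >= 0 of q (x + t y) - t q y is the largest
    sublinear functional below q with r (- y) <= - q y.  It shows that a minimal q is
    additive, and, taken before minimizing, it prescribes the value at y. *)
Lemma sublinear_descent q y : sublinear q ->
  exists r, [/\ sublinear r, forall x, r x <= q x & forall x, r x <= q (x + y) - q y].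
Proof.
move=> q_sub; have [qD qZ] := q_sub.
pose F x : set R := [set q (x + t *: y) - t * q y | t in [set t | 0 <= t]].
have Fb x : has_lbound (F x).
  exists (- q (- x)) => _ [t /= t0 <-].
  have : t * q y <= q (t *: y).
    have [->|tn0] := eqVneq t 0; first by rewrite scale0r mul0r sublinear0.
    have tp : 0 < t by rewrite lt_def tn0.
    have := qZ t^-1 (t *: y) ltac:(by rewrite invr_gt0).
    by rewrite scalerA mulVf// scale1r ler_pdivlMl.
  by have := qD (x + t *: y) (- x); rewrite addrAC subrr add0r; lra.
exists (fun x => inf (F x)); split.
- apply: inf_sublinear => //.
  + by move=> x; exists (q (x + 0 *: y) - 0 * q y), 0 => /=.
  + move=> x x' _ _ [t /= t0 <-] [s /= s0 <-].
    exists (q (x + x' + (t + s) *: y) - (t + s) * q y).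
      by exists (t + s) => //=; exact: addr_ge0.
    by have := qD (x + t *: y) (x' + s *: y); rewrite addrACA -scalerDl; lra.
  + move=> t x _ t0 [s /= s0 <-].
    exists (q (t *: x + (t * s) *: y) - (t * s) * q y).
      by exists (t * s) => //=; rewrite mulr_ge0// ltW.
    have := qZ t (x + s *: y) t0; rewrite scalerDr scalerA; lra.
- move=> x; apply: ge_inf => //; exists 0 => //=.
  by rewrite scale0r addr0 mul0r subr0.
- move=> x; apply: ge_inf => //; exists 1 => //=.
  by rewrite scale1r mul1r.
Qed.

Lemma sublinear_minimal_linear q : sublinear q ->
  (forall r, sublinear r -> (forall x, r x <= q x) -> r = q) ->
  (forall x y, q (x + y) = q x + q y) /\ (forall t x, q (t *: x) = t * q x).
Proof.
move=> q_sub qmin.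
have q_add x y : q (x + y) = q x + q y.
  have [r [r_sub rq rqy]] := sublinear_descent y q_sub.
  have {}qmin := qmin r r_sub rq; have := rqy x; rewrite qmin => h.
  by apply/eqP; rewrite eq_le q_sub.1/=; lra.
have qN x : q (- x) = - q x.
  by have := q_add x (- x); rewrite subrr sublinear0//; lra.
have qZ t x : 0 < t -> q (t *: x) = t * q x.
  move=> t0; have := q_sub.2 t x t0; have := q_sub.2 t (- x) t0.
  by rewrite scalerN !qN => h1 h2; apply/eqP; rewrite eq_le h2/=; lra.
split=> // t x; case: (ltrgtP t 0) => [t0|t0|->]; first last.
- by rewrite scale0r mul0r sublinear0.
- exact: qZ.
- by rewrite -[t]opprK scaleNr qN qZ ?oppr_gt0//; ring.
Qed.

End Sublinear.

Section HahnBanach.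
Variables (R : realType) (X : normedModType R).

Lemma dual_of_bound (f : X -> R^o) (c : R) :
  (forall x y, f (x + y) = f x + f y) -> (forall t x, f (t *: x) = t * f x) ->
  (forall x, `|f x| <= c * `|x|) -> exists u : dual_space X, forall x, u x = f x.
Proof.
move=> fD fZ fc.
have f_lin : linear f by move=> t x y; rewrite fD fZ.
pose L := GRing.isLinear.Build _ _ _ _ f f_lin.
pose g : {linear X -> R^o} := HB.pack f L.
suff g_cont : continuous (g : X -> R^o) by exists (Dual g_cont).
apply: bounded_linear_continuous; apply/linear_boundedP.
near=> r => x; apply: le_trans (fc x) _; apply: ler_wpM2r => //.
by near: r; apply: nbhs_pinfty_ge; rewrite num_real.
Unshelve. all: by end_near.
Qed.

(** Minimizing below the descent of the norm along e forces the linear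
    functional q so obtained to satisfy q (- e) <= - |e|. *)
Lemma norming_functional (e : X) : exists u : dual_space X, u e = `|e|.
Proof.
pose p (x : X) := `|x| : R.
have p_sub : sublinear p.
  by split=> [x y|t x t0]; [exact: ler_normD|rewrite /p normrZ gtr0_norm].
have [r [r_sub rp rpe]] := sublinear_descent e p_sub.
have [q [q_sub qr qmin]] := sublinear_minimal r_sub.
have [qD qZ] := sublinear_minimal_linear q_sub qmin.
have qp x : q x <= `|x| by exact: le_trans (qr x) (rp x).
have qN x : q (- x) = - q x by rewrite -scaleN1r qZ mulN1r.
have q_bound x : `|q x| <= 1 * `|x|.
  rewrite mul1r ler_norml qp andbT.
  by have := qp (- x); rewrite normrN qN; lra.
have [u uq] := dual_of_bound qD qZ q_bound.
exists u; rewrite uq; apply/eqP; rewrite eq_le qp/=.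
by have := qr (- e); have := rpe (- e); rewrite qN addNr /p normr0; lra.
Qed.

End HahnBanach.

(** * Dual norms and functionals on a quotient *)

Section Dual.
Variables (R : realType) (X : normedModType R).
Implicit Types (f g : dual_space X) (u : X -> R).

Lemma dual_boundE f : exists c, forall x, `|f x| <= c * `|x|.
Proof.
have f_cont : {for 0, continuous (f : X -> R^o)} by exact: dual_continuous.
have /linear_boundedP f_bnd := continuous_linear_bounded 0 f_cont.
have [c c_bnd] := filter_ex f_bnd.
by exists c.
Qed.

Lemma opnorm_ge0 u : 0 <= opnorm u.
Proof.
rewrite /opnorm; set S := (X in sup X).
have [S_sup|S_nsup] := pselect (has_sup S); last by rewrite sup_out.
have [[_ [x x1 _]] ubS] := S_sup.
by apply: le_trans (normr_ge0 (u x)) _; apply: ub_le_sup => //; exists x.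
Qed.

Lemma opnorm_le u c : (forall x, `|x| <= 1 -> `|u x| <= c) -> opnorm u <= c.
Proof.
move=> uc; apply: ge_sup => [|_ [x x1 <-]]; last exact: uc.
by exists `|u 0|, 0 => //=; rewrite normr0.
Qed.

(** Some finite bound c must be assumed: the supremum of an unbounded set is 0. *)
Lemma opnorm_bound u c : (forall t x, u (t *: x) = t * u x) ->
  (forall x, `|u x| <= c * `|x|) -> forall x, `|u x| <= opnorm u * `|x|.
Proof.
move=> uZ uc x; have [->|x0] := eqVneq x 0.
  by rewrite -(scale0r 0) uZ mul0r normr0 mulr_ge0// opnorm_ge0.
have nx : 0 < `|x| by rewrite normr_gt0.
rewrite -ler_pdivrMr//.
have -> : `|u x| / `|x| = `|u (`|x|^-1 *: x)|.
  by rewrite uZ normrM gtr0_norm ?invr_gt0// mulrC.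
apply: ub_le_sup.
  exists `|c| => _ [y /= y1 <-]; apply: le_trans (uc y) _.
  rewrite (le_trans (ler_norm _))// normrM normr_id.
  by rewrite ler_piMr.
by exists (`|x|^-1 *: x) => //=; rewrite normrZ normfV normr_id mulVf// gt_eqF.
Qed.

Lemma dual_bound f x : `|f x| <= opnorm f * `|x|.
Proof.
have [c fc] := dual_boundE f; apply: opnorm_bound fc _ => t y.
exact: linearZ.
Qed.

End Dual.

Section Quotient.
Variables (R : realType) (X : normedModType R) (Y : closed_subspace X).
Local Notation Z := (quotient_space Y).
Local Notation pi := (@quotient_pi R X Y).

Lemma quotient_piB x y : pi (x - y) = pi x - pi y.
Proof. by rewrite /quotient_pi !piE. Qed.

Lemma quotient_pi_le x : `|pi x| <= `|x|.
Proof. by apply: ge_inf; [exists 0 => _ [y _ <-]|exists x]. Qed.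

(** The quotient norm is an infimum over representatives, so a lower bound for
    all representatives passes to it. *)
Lemma quotient_le_norm (z : Z) (c s : R) : 0 <= s ->
  (forall x, pi x = z -> c <= s * `|x|) -> c <= s * `|z|.
Proof.
move=> s0 cx; have [x xz] := quotient_piK z.
have [s00|sn0] := eqVneq s 0; first by have := cx x xz; rewrite s00 !mul0r.
have sp : 0 < s by rewrite lt_def sn0.
rewrite -ler_pdivrMl//; apply: lb_le_inf; first by exists `|x|, x.
by move=> _ [y yz <-]; rewrite ler_pdivrMl//; exact: cx.
Qed.

(** The dual of X/Y embeds isometrically in the dual of X.  The lemma
    speaks of bounded homogeneous functions because it is applied to the
    difference of two functionals, which is not itself a term of the dual. *)
Lemma quotient_opnorm (u : Z -> R) (c : R) : (forall t z, u (t *: z) = t * u z) ->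
  (forall z, `|u z| <= c * `|z|) -> opnorm (u \o pi) = opnorm u.
Proof.
move=> uZ uc; have uB := opnorm_bound uZ uc.
have upiZ t x : (u \o pi) (t *: x) = t * (u \o pi) x.
  by rewrite /= -quotient_piZ uZ.
have upi_c x : `|(u \o pi) x| <= opnorm u * `|x|.
  apply: le_trans (uB _) _.
  by apply: ler_wpM2l (quotient_pi_le x); exact: opnorm_ge0.
have upiB := opnorm_bound upiZ upi_c.
apply/eqP; rewrite eq_le; apply/andP; split; apply: opnorm_le.
  move=> x x1; by apply: le_trans (upi_c x) _; rewrite ler_piMr//; exact: opnorm_ge0.
move=> z z1; apply: (@le_trans _ _ (opnorm (u \o pi) * `|z|)).
  apply: quotient_le_norm => [|x <-]; first exact: opnorm_ge0.
  exact: upiB.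
by rewrite ler_piMr//; exact: opnorm_ge0.
Qed.

Lemma dual_pullback (u : dual_space Z) :
  exists f : dual_space X, forall x, f x = u (pi x).
Proof.
apply: (@dual_of_bound _ _ (fun x => u (pi x)) (opnorm u)).
- by move=> x y; rewrite quotient_piD linearD.
- by move=> t x; rewrite -quotient_piZ linearZ.
- move=> x; apply: le_trans (dual_bound _ _) _.
  by apply: ler_wpM2l (quotient_pi_le x); exact: opnorm_ge0.
Qed.

Lemma dual_descend (f : dual_space X) : (forall y, y \in subspace_pred Y -> f y = 0) ->
  exists u : dual_space Z, forall x, u (pi x) = f x.
Proof.
move=> fY; pose u (z : Z) : R^o := f (repr z).
have uE x : u (pi x) = f x.
  apply/eqP; rewrite -subr_eq0 -linearB; apply/eqP/fY.
  by apply/quotient_piP; rewrite /quotient_pi reprK.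
have [|||v vu] := @dual_of_bound _ _ u (opnorm f).
- move=> z w; have [x <-] := quotient_piK z; have [y <-] := quotient_piK w.
  by rewrite -quotient_piD !uE linearD.
- move=> t z; have [x <-] := quotient_piK z.
  by rewrite [t *: _]quotient_piZ !uE linearZ.
- move=> z; apply: quotient_le_norm => [|x <-]; first exact: opnorm_ge0.
  by rewrite uE; exact: dual_bound.
by exists v => x; rewrite vu uE.
Qed.

(** A norming functional of the class of e in the quotient, read on X. *)
Lemma subspace_separation e : e \notin subspace_pred Y ->
  exists f : dual_space X, (forall y, y \in subspace_pred Y -> f y = 0) /\ f e != 0.
Proof.
move=> eY; have [u ue] := norming_functional (pi e).
have [f fu] := dual_pullback u; exists f; split=> [y yY|]; rewrite fu.
  have -> : pi y = 0; last exact: linear0.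
  by rewrite -quotient_pi0; apply/quotient_piP; rewrite subr0.
rewrite ue normr_eq0; apply: contra eY => /eqP.
by rewrite -quotient_pi0 => /quotient_piP; rewrite subr0.
Qed.

End Quotient.

(** * Compactness and countable tightness *)

Lemma countable_setU (T : Type) (A B : set T) :
  countable A -> countable B -> countable (A `|` B).
Proof.
by move=> A_cnt B_cnt; rewrite -bigcup2E; apply: bigcup_countable => // -[|[|n]].
Qed.

Section Compactness.
Implicit Types T : topologicalType.

(** Near-covering compactness for the filter generated by the finite sets of
    indices: near each point of K, every set of indices that contains a suitable
    one covers. *)
Lemma compact_subcover T (K : set T) (I : Type) (S : set I) (P : I -> set T) :
  compact K -> (forall i, S i -> open (P i)) -> K `<=` \bigcup_(i in S) P i ->
  exists A : set I, [/\ finite_set A, A `<=` S & K `<=` \bigcup_(i in A) P i].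
Proof.
move=> /compact_near_coveringP K_cov P_open KP.
pose D (A : set I) := finite_set A /\ A `<=` S.
pose F := filter_from D (fun A => [set B | A `<=` B]).
have F_filter : Filter F.
  apply: filter_from_filter => [|A B [A_fin AS] [B_fin BS]].
    by exists set0; split=> //; exact: finite_set0.
  exists (A `|` B).
    by split; [rewrite finite_setU|move=> i [/AS|/BS]].
  by move=> C ABC; split=> i Ci; apply: ABC; [left|right].
have [x Kx|A [A_fin AS] AK] := K_cov _ F (fun B x => exists2 i, B i & P i x) F_filter.
  have [i Si Pix] := KP x Kx; exists (P i, [set B | B i]).
    split => /=; first by apply: open_nbhs_nbhs; split=> //; exact: P_open.
    exists [set i]; last by move=> B; apply.
    by split; [exact: finite_set1|move=> _ ->].
  by move=> [y B] [/= Piy Bi]; exists i.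
by exists A; split=> //; apply: AK.
Qed.

(** The theorem of Arkhangelskii and Pytkeev on function spaces over a compact
    space, with phi i read as the distance between the i-th function and the
    limit.  For fixed n and k, the n-tuples at which phi i is less than
    1/(k+1) form an open set, and these sets cover the compact power of K; a
    finite subcover for each (n, k) gives A. *)
Lemma compact_countably_tight T (R : realType) (K : set T) (I : Type) (S : set I)
    (phi : I -> T -> R^o) :
  compact K -> (forall i, S i -> continuous (phi i)) ->
  (forall (s : seq T) e, 0 < e -> {in s, forall x, K x} ->
    exists2 i, S i & forall x, x \in s -> phi i x < e) ->
  exists A : set I, [/\ countable A, A `<=` S &
    forall (s : seq T) e, 0 < e -> {in s, forall x, K x} ->
      exists2 i, A i & forall x, x \in s -> phi i x < e].
Proof.
move=> K_cpt phi_cont S_small.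
have finA (nk : nat * nat) : exists A : set I, [/\ finite_set A, A `<=` S &
    forall x : 'I_nk.1 -> T, (forall j, K (x j)) ->
      exists2 i, A i & forall j, phi i (x j) < nk.2.+1%:R^-1].
  case: nk => n k /=; pose Tn := prod_topology (fun _ : 'I_n => T).
  pose Kn : set Tn := [set x | forall j, K (x j)].
  pose P i : set Tn := [set x | forall j, phi i (x j) < k.+1%:R^-1].
  have Kn_cpt : compact Kn by exact: (@tychonoff _ (fun _ : 'I_n => T) (fun=> K)).
  have [i Si|x Kx|A [A_fin AS KA]] := @compact_subcover _ Kn I S P Kn_cpt.
  - rewrite openE => x Px.
    apply: (@filter_forall Tn 'I_n (fun j y => phi i (y j) < k.+1%:R^-1)
      (nbhs x)) => j.
    have phij_cont : continuous (fun y : Tn => phi i (y j)).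
      move=> y; apply: (@continuous_comp _ _ _ (fun y : Tn => y j)).
        exact: (@proj_continuous _ (fun _ : 'I_n => T)).
      exact: phi_cont.
    exact: (phij_cont x _ (lt_nbhsl (Px j))).
  - have [||i Si phi_lt] := S_small (codom x) k.+1%:R^-1.
    + by [].
    + by move=> _ /codomP[j ->].
    + by exists i => // j; exact/phi_lt/codom_f.
  - by exists A; split.
have [A AE] := choice finA.
exists (\bigcup_nk A nk); split.
- apply: bigcup_countable => // nk _; apply: finite_set_countable.
  by have [] := AE nk.
- by move=> i [nk _]; have [_ AS _] := AE nk; exact: AS.
- move=> s e e0 Ks; have [k _ ke] := near_infty_natSinv_lt (PosNum e0).
  have [_ _ /(_ (fun j => tnth (in_tuple s) j))[|i Ai phi_lt]] := AE (size s, k).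
    by move=> j; apply: Ks; exact: mem_tnth.
  exists i; first by exists (size s, k).
  move=> x /(tnthP (in_tuple s))[j ->]; apply: lt_trans (phi_lt j) _.
  exact: ke k (leqnn _).
Qed.

End Compactness.

(** * Weak topologies and clustering pairs of functionals *)

Section Weak.
Variables (R : realType) (X : normedModType R).

Lemma weak_eval_continuous (f : dual_space X) :
  continuous (fun x : weak X => f x : R^o).
Proof.
move=> x; apply: (@continuous_comp _ {ptws dual_space X -> R^o} _
  (fun (x : weak X) (g : dual_space X) => g x : R^o) (fun h => h f)).
  exact: initial_continuous.
exact: (@proj_continuous _ (fun _ : dual_space X => R^o)).
Qed.

Lemma weak_star_near (I : Type) (F : set_system I) (g : I -> weak_star X) (f : weak_star X) :
  Filter F ->
  (forall x e, 0 < e -> \forall i \near F, `|(g i : dual_space X) x - (f : dual_space X) x| < e) ->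
  forall U, open U -> U f -> \forall i \near F, U (g i).
Proof.
move=> F_filter gf U [W W_open <-] /= Wf.
pose ev (h : weak_star X) : {ptws X -> R^o} := (h : dual_space X) : X -> R^o.
have : (ev \o g) @ F --> ev f.
  apply/cvg_sup => x N [_ [[V V_open <-] Vf VN]]; apply: (filterS VN).
  have /nbhs_ballP[e /= e0 eV] := open_nbhs_nbhs (conj V_open Vf).
  near=> i; apply: eV; rewrite -ball_normE /= distrC.
  by near: i; exact: gf.
by apply; exact: open_nbhs_nbhs.
Unshelve. all: by end_near.
Qed.

Lemma weak_star_basic_open (f : weak_star X) (s : seq X) (e : R) : 0 < e ->
  exists2 U : set (weak_star X), open U /\ U f &
    forall g, U g -> forall x, x \in s -> `|(g : dual_space X) x - (f : dual_space X) x| < e.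
Proof.
move=> e0.
pose ev (h : weak_star X) : {ptws X -> R^o} := (h : dual_space X) : X -> R^o.
have ev_cont x : continuous (fun g => ev g x).
  move=> g; apply: (@continuous_comp _ {ptws X -> R^o} _ ev (fun h => h x)).
    exact: initial_continuous.
  exact: (@proj_continuous _ (fun _ : X => R^o)).
have : nbhs f [set g | forall j : 'I_(size s), `|ev g s`_j - ev f s`_j| < e].
  apply: (@filter_forall (weak_star X) 'I_(size s)
    (fun j g => `|ev g s`_j - ev f s`_j| < e) (nbhs f)) => j.
  by have /cvgrPdistC_lt := ev_cont s`_j f; apply.
rewrite nbhsE => -[U [U_open Uf] Us]; exists U => // g Ug x /(nthP 0)[j js <-].
exact: (Us g Ug (Ordinal js)).
Qed.

(** A diameter above e is witnessed by two points, which turns survival of f into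
    the clustering of pairs at (f, f). *)
Lemma szlenk_derivationP e (L : set (weak_star X)) f :
  szlenk_derivation e L f <-> L f /\ forall U : set (weak_star X), open U -> U f ->
    exists g h : dual_space X, [/\ L g, L h, U g, U h & e < opnorm (fun x => g x - h x)].
Proof.
split=> [[Lf Lnf]|[Lf Lpair]]; split=> //.
  move=> U U_open Uf; apply: contrapT => nogh; apply: Lnf.
  exists (L `&` U) => //; split; first by exists U.
  apply: ub_ereal_sup => _ [[g h] [[Lg Ug] [Lh Uh]] <-]; rewrite lee_fin leNgt.
  by apply/negP => e_lt; apply: nogh; exists g, h.
move=> [V [[U U_open ->] dV] [_ Uf]].
have [g [h [Lg Lh Ug Uh]]] := Lpair U U_open Uf.
apply/negP; rewrite -leNgt -lee_fin; apply: le_trans dV.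
by apply: ereal_sup_ubound; exists (g, h).
Qed.

Lemma linear_span_closed_ind (K : set X) (E : set X) :
  closure (linear_span K) = [set: X] -> closed E -> E 0 ->
  (forall x y, E x -> E y -> E (x + y)) -> (forall t x, E x -> E (t *: x)) ->
  K `<=` E -> forall x, E x.
Proof.
move=> K_dense E_closed E0 ED EZ KE x.
have : closure (linear_span K) x by rewrite K_dense.
rewrite [E](closure_id _).1//; apply: closure_subset => _ [n [c [v [Kv ->]]]].
by elim/big_ind : _ => // i _; apply/EZ/KE.
Qed.

End Weak.

Section Pairs.
Variables (R : realType) (X : normedModType R) (f : dual_space X).

Implicit Types p : dual_space X * dual_space X.

(** A seminorm of x, whose convergence to 0 along a filter of pairs says that both
    components converge to f at x. *)
Definition pair_error (p : dual_space X * dual_space X) (x : X) : R :=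
  `|p.1 x - f x| + `|p.2 x - f x|.

Lemma pair_errorD p x y : pair_error p (x + y) <= pair_error p x + pair_error p y.
Proof.
have errD (g : dual_space X) : `|g (x + y) - f (x + y)| <= `|g x - f x| + `|g y - f y|.
  by rewrite (linearD g) (linearD f) opprD addrACA ler_normD.
by rewrite /pair_error; have := errD p.1; have := errD p.2; lra.
Qed.

Lemma pair_errorZ p t x : pair_error p (t *: x) = `|t| * pair_error p x.
Proof.
have dualZ (g : dual_space X) : g (t *: x) = t * g x by exact: linearZ.
by rewrite /pair_error !dualZ -!mulrBr !normrM mulrDr.
Qed.

Lemma pair_error_le p x : opnorm f <= 1 -> opnorm p.1 <= 1 -> opnorm p.2 <= 1 ->
  pair_error p x <= 4 * `|x|.
Proof.
move=> f1 p1 p2.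
have ball_le (g : dual_space X) : opnorm g <= 1 -> `|g x| <= `|x|.
  by move=> g1; apply: le_trans (dual_bound g x) _; rewrite ler_piMl.
rewrite /pair_error.
have := ler_normB (p.1 x) (f x); have := ler_normB (p.2 x) (f x).
by have := ball_le _ f1; have := ball_le _ p1; have := ball_le _ p2; lra.
Qed.

Lemma pair_error_continuous p : continuous (pair_error p : weak X -> R^o).
Proof.
have dist_cont (g : dual_space X) :
    continuous ((fun y => `|g y - f y|) : weak X -> R^o).
  move=> x; apply: (@cvg_norm _ R^o (weak X) (nbhs x) _ (fun y => g y - f y)).
  by apply: (@cvgB _ R^o); exact: weak_eval_continuous.
by move=> x; exact: (cvgD (dist_cont p.1 x) (dist_cont p.2 x)).
Qed.

(** Tightness provides countably many pairs that approximate (f, f) on finite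
    subsets of K; these approximations generate the filter F.  The points at
    which the error tends to 0 along F form a subspace, closed because
    the errors are uniformly Lipschitz on the dual ball, so it is all of X. *)
Lemma pairs_cluster_countable (K : set X) (S : set (dual_space X * dual_space X)) :
  compact (K : set (weak X)) -> closure (linear_span K) = [set: X] ->
  opnorm f <= 1 -> (forall p, S p -> opnorm p.1 <= 1 /\ opnorm p.2 <= 1) ->
  (forall U : set (weak_star X), open U -> U f -> exists2 p, S p & U p.1 /\ U p.2) ->
  exists (A : set (dual_space X * dual_space X))
         (F : set_system (dual_space X * dual_space X)),
    [/\ countable A, A `<=` S, ProperFilter F, F A &
     forall x e, 0 < e -> \forall p \near F, pair_error p x < e].
Proof.
move=> K_cpt K_dense f1 S1 S_cluster.
have [|p _|s e e0 _|A [A_cnt AS A_small]] :=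
  @compact_countably_tight (weak X) R K _ S pair_error.
- exact: K_cpt.
- exact: pair_error_continuous.
- have [U [U_open Uf] Us] := @weak_star_basic_open _ _ f s (e / 2) ltac:(by rewrite divr_gt0).
  have [p Sp [Up1 Up2]] := S_cluster U U_open Uf; exists p => // x xs.
  by rewrite /pair_error; have := Us _ Up1 x xs; have := Us _ Up2 x xs; lra.
pose D (se : seq X * R) := 0 < se.2 /\ {in se.1, forall x, K x}.
pose B (se : seq X * R) := A `&` [set p | forall x, x \in se.1 -> pair_error p x < se.2].
pose F := filter_from D B.
have F_filter : Filter F.
  apply: filter_from_filter; first by exists ([::], 1); split => //=.
  move=> [s d] [t e] [/= d0 Ks] [/= e0 Kt]; exists (s ++ t, Num.min d e).
    split=> /=; first by rewrite lt_min d0.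
    by move=> x; rewrite mem_cat => /orP[/Ks|/Kt].
  move=> p [Ap p_small]; split; split=> // x xs.
    by have := p_small x; rewrite mem_cat xs lt_min => /(_ isT)/andP[].
  by have := p_small x; rewrite mem_cat xs orbT lt_min => /(_ isT)/andP[].
have FA : F A by exists ([::], 1); [split|move=> p []].
exists A, F; split=> //.
  apply: filter_from_proper => // -[s e] [/= e0 Ks].
  by have [p Ap p_small] := A_small s e e0 Ks; exists p.
pose E : set X := [set x | forall e, 0 < e -> \forall p \near F, pair_error p x < e].
apply: (@linear_span_closed_ind _ _ K E) => //.
- move=> x Ex e e0.
  (* the error is 4-Lipschitz: moving by e / 8 costs at most e / 2 *)
  have [y [Ey]] : E `&` ball x (e / 8) !=set0.
    by apply: Ex; apply: nbhsx_ballx; rewrite divr_gt0.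
  rewrite -ball_normE /= => xy.
  near=> p.
  have [p1 p2] : opnorm p.1 <= 1 /\ opnorm p.2 <= 1 by apply/S1/AS; near: p.
  have -> : x = y + (x - y) by rewrite addrC subrK.
  apply: le_lt_trans (pair_errorD _ _ _) _.
  have := pair_error_le (x - y) f1 p1 p2.
  have : pair_error p y < e / 2 by near: p; apply: Ey; rewrite divr_gt0.
  lra.
- move=> e e0; near=> p.
  by rewrite -(scale0r 0) pair_errorZ normr0 mul0r.
- move=> x y Ex Ey e e0; near=> p.
  apply: le_lt_trans (pair_errorD _ _ _) _.
  rewrite [e]splitr ltrD//.
    by near: p; apply: Ex; rewrite divr_gt0.
  by near: p; apply: Ey; rewrite divr_gt0.
- move=> t x Ex e e0; near=> p.
  rewrite pair_errorZ.
  have t1 : 0 < `|t| + 1 by rewrite ltr_wpDl.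
  have px : pair_error p x < e / (`|t| + 1).
    by near: p; apply: Ex; rewrite divr_gt0.
  rewrite ltr_pdivlMr// in px; apply: le_lt_trans px.
  by rewrite mulrC ler_wpM2l ?lerDl// /pair_error addr_ge0.
- move=> x Kx e e0; exists ([:: x], e).
    by split=> //= y; rewrite inE => /eqP ->.
  by move=> p [_ /(_ x)]; apply; rewrite mem_head.
Unshelve. all: by end_near.
Qed.

End Pairs.

(** * Separable quotients *)

Section SeparableSpan.
Variables (R : realType) (X : normedModType R) (D : set X).

(** Sums of n terms, each a rational multiple of a point of D; repetition
    is allowed. *)
Fixpoint rational_comb n : set X :=
  if n is m.+1 then
    [set ratr qdc.1.1 *: qdc.1.2 + qdc.2
      | qdc in ([set: rat] `*` D) `*` rational_comb m]
  else [set 0].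

Definition rational_span : set X := \bigcup_n rational_comb n.

Lemma rational_span0 : rational_span 0.
Proof. by exists 0%N. Qed.

Lemma rational_span_cons q d c : D d -> rational_span c -> rational_span (ratr q *: d + c).
Proof. by move=> Dd [n _ cn]; exists n.+1 => //; exists (q, d, c). Qed.

Lemma rational_spanD x y : rational_span x -> rational_span y -> rational_span (x + y).
Proof.
move=> [n _]; elim: n x => [|n IH] x; first by move=> -> ?; rewrite add0r.
move=> [[[q d] c] [[_ Dd] /= cn] <-] y_span /=.
by rewrite -addrA; apply: rational_span_cons => //; exact: IH.
Qed.

Lemma rational_spanZ q x : rational_span x -> rational_span (ratr q *: x).
Proof.
move=> [n _]; elim: n x => [|n IH] x.
  by move=> ->; rewrite scaler0; exact: rational_span0.
move=> [[[r d] c] [[_ Dd] /= cn] <-] /=.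
rewrite scalerDr scalerA -rmorphM; apply: rational_span_cons => //; exact: IH.
Qed.

Lemma countable_rational_span : countable D -> countable rational_span.
Proof.
move=> D_cnt; apply: bigcup_countable => // n _.
elim: n => [|n IH] /=; first exact: countable1.
apply: sub_countable (card_image_le _ _) _.
by apply: countableX => //; exact: countableX.
Qed.

Lemma closure_ballP (C : set X) x :
  closure C x <-> forall e, 0 < e -> exists2 c, C c & `|x - c| < e.
Proof.
split=> [Cx e e0|Cx B /nbhs_ballP[e /= e0 eB]].
  by have [c [Cc]] := Cx _ (nbhsx_ballx x e e0); rewrite -ball_normE; exists c.
by have [c Cc xc] := Cx e e0; exists c; split=> //; apply: eB; rewrite -ball_normE.
Qed.

Definition closed_span_pred : {pred X} := fun x => `[< closure rational_span x >].

(** Real scalars are reached by approximating t from below by a rational. *)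
Lemma closed_span_submod : submod_closed closed_span_pred.
Proof.
split=> [|t x y]; rewrite ?inE => /=.
  by apply: subset_closure; exact: rational_span0.
move=> /closure_ballP x_cl /closure_ballP y_cl; apply/closure_ballP => e e0.
have e3 : 0 < e / 3 by rewrite divr_gt0.
have t1 : 0 < `|t| + 1 by rewrite ltr_wpDl.
have [c c_span xc] := x_cl _ (divr_gt0 e3 t1).
have c1 : 0 < `|c| + 1 by rewrite ltr_wpDl.
have [d d_span yd] := y_cl _ e3.
have [q] := @rat_in_itvoo R (t - (e / 3) / (`|c| + 1)) t
  ltac:(by rewrite ltrBlDr ltrDl divr_gt0).
rewrite in_itv /= => /andP[q_gt q_lt].
exists (ratr q *: c + d).
  by apply: rational_spanD => //; exact: rational_spanZ.
have -> : t *: x + y - (ratr q *: c + d) = t *: (x - c) + (t - ratr q) *: c + (y - d).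
  by rewrite scalerBr scalerBl subrKA opprD addrACA.
apply: le_lt_trans (ler_normD _ _) _.
apply: le_lt_trans (lerD (ler_normD _ _) (lexx _)) _; rewrite !normrZ.
have h1 : `|t| * `|x - c| <= e / 3.
  rewrite ltr_pdivlMr// in xc; apply: le_trans (ltW xc).
  by rewrite mulrC ler_wpM2l ?lerDl.
have h2 : `|t - ratr q| * `|c| <= e / 3.
  rewrite gtr0_norm ?subr_gt0//.
  have : t - ratr q < e / 3 / (`|c| + 1) by lra.
  rewrite ltr_pdivlMr// => /ltW; apply: le_trans.
  by rewrite ler_wpM2l ?lerDl// subr_ge0 ltW.
lra.
Qed.

Lemma closed_span_closed : closed [set` closed_span_pred].
Proof.
rewrite (_ : [set` _] = closure rational_span); first exact: closed_closure.
by apply/seteqP; split=> x; [move/asboolP|move=> ?; exact/asboolP].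
Qed.

Definition closed_span : closed_subspace X :=
  ClosedSubspace closed_span_submod closed_span_closed.

Lemma sub_closed_span d : D d -> d \in subspace_pred closed_span.
Proof.
move=> Dd; apply/asboolP; apply: subset_closure.
rewrite -[d]scale1r -[d]addr0 scalerDr scaler0 -[1](rmorph1 (@ratr R)).
exact: rational_span_cons Dd rational_span0.
Qed.

End SeparableSpan.

Section Annihilator.
Variables (R : realType) (X : normedModType R) (A : set (dual_space X)).

Definition annihilator_pred : {pred X} := fun x => `[< forall f, A f -> f x = 0 >].

Lemma annihilator_submod : submod_closed annihilator_pred.
Proof.
split=> [|t x y].
  by apply/asboolP => f _; exact: linear0.
move=> /asboolP x0 /asboolP y0; apply/asboolP => f Af.
by rewrite linearP x0// y0// scaler0 addr0.
Qed.

Lemma annihilator_closed : closed [set` annihilator_pred].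
Proof.
rewrite (_ : [set` _] = \bigcap_(f in A) ((f : X -> R^o) @^-1` [set 0])).
  apply: closed_bigI => f _; apply: closed_comp => [x _|]; last exact: closed_eq.
  exact: dual_continuous.
apply/seteqP; split=> x; first by move=> /asboolP x0 f Af; exact: x0.
by move=> x0; apply/asboolP => f Af; exact: x0.
Qed.

Definition annihilator : closed_subspace X :=
  ClosedSubspace annihilator_submod annihilator_closed.

Lemma in_annihilator x :
  x \in subspace_pred annihilator <-> forall f, A f -> f x = 0.
Proof. by split=> [/asboolP|?]; [|exact/asboolP]. Qed.

(** The weak compactness of K is used twice: finitely many points of K suffice to
    approximate K within 1/(m+1) on the first m functionals, which yields D, and
    points of D approaching x on A have a weak cluster point. *)
Lemma separable_annihilator_quotient (K : set X) :
  compact (K : set (weak X)) -> closure (linear_span K) = [set: X] ->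
  countable A -> separable (quotient_space annihilator).
Proof.
move=> K_cpt K_dense A_cnt.
have [f0 _] := norming_functional (0 : X).
have [a Aa] : exists a : nat -> dual_space X, A `<=` range a.
  have /countable_injP[i i_inj] := A_cnt.
  exists (fun n => xget f0 [set g | A g /\ i g = n]) => f Af; exists (i f) => //.
  have [] := xgetPex f0 (ex_intro [set g | A g /\ i g = i f] f (conj Af erefl)).
  by move=> Ag /i_inj; rewrite !inE; exact.
pose near_pt m (d : X) : set (weak X) :=
  [set x | forall j : 'I_m, `|a j d - a j x| < m.+1%:R^-1].
have near_pt_open m d : open (near_pt m d).
  rewrite openE => x dx.
  apply: (@filter_forall (weak X) 'I_m (fun j y => `|a j d - a j y| < m.+1%:R^-1)
    (nbhs x)) => j.
  have dist_cont : continuous ((fun y => `|a j d - a j y|) : weak X -> R^o).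
    move=> y; apply: (@cvg_norm _ R^o (weak X) (nbhs y) _ (fun y => a j d - a j y)).
    by apply: (@cvgB _ R^o); [exact: cvg_cst|exact: weak_eval_continuous].
  exact: (dist_cont x _ (lt_nbhsl (dx j))).
have /choice[Dm DmE] m : exists B : set X, [/\ finite_set B, B `<=` K &
    K `<=` \bigcup_(d in B) near_pt m d].
  apply: (@compact_subcover (weak X)) => // x Kx; exists x => // j.
  by rewrite subrr normr0.
pose D := \bigcup_m Dm m.
have D_cnt : countable D.
  by apply: bigcup_countable => // m _; apply: finite_set_countable; have [] := DmE m.
pose E := closed_span D.
have KE x : K x -> exists2 e, e \in subspace_pred E &
    quotient_pi annihilator x = quotient_pi annihilator e.
  move=> Kx.
  (* points of D that approach x on the functionals a 0, a 1, ... *)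
  pose G : set_system (weak X) := filter_from [set: nat]
    (fun m => (D `&` K) `&` [set d | forall j : 'I_m, `|a j d - a j x| < m.+1%:R^-1]).
  have G_filter : Filter G.
    apply: filter_from_filter; first by exists 0%N.
    move=> m n _ _; exists (maxn m n) => // d [Dd dx].
    have dx' k (j : 'I_k) : (k <= maxn m n)%N -> `|a j d - a j x| < k.+1%:R^-1.
      move=> kmn; have := dx (widen_ord kmn j) => /lt_le_trans; apply.
      by rewrite lef_pV2 ?posrE// ler_nat.
    by split; split=> // j; apply: dx'; rewrite ?leq_maxl ?leq_maxr.
  have G_proper : ProperFilter G.
    apply: filter_from_proper => // m _; have [_ DmK /(_ x Kx)[d Dmd dx]] := DmE m.
    by exists d; split=> //; split; [exists m|exact: DmK].
  have GD : G (D `&` K) by exists 0%N => // d [].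
  have GK : G K by apply: filterS GD => d [].
  have [e [_ e_cl]] := K_cpt G G_proper GK.
  have e_near (f : dual_space X) (B : set X) (r : R) : G B -> 0 < r ->
      exists2 d, B d & `|f e - f d| < r.
    move=> GB r0; have := @weak_eval_continuous R X f e.
    move=> /cvgrPdist_lt/(_ r r0) fe.
    by have [d [Bd ed]] := e_cl _ _ GB fe; exists d.
  (* a functional vanishing on E but not at e would keep e away from D *)
  exists e.
    apply: contrapT => /negP eE; have [f [fE fe]] := subspace_separation eE.
    have [d [Dd _]] := e_near f _ `|f e| GD ltac:(by rewrite normr_gt0).
    have -> : f d = 0 by apply: fE; exact: sub_closed_span.
    by rewrite subr0 ltxx.
  apply/quotient_piP/in_annihilator => f /Aa[j _ <-].
  apply/eqP; rewrite linearB subr_eq0; apply: contraT => xe.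
  have r0 : 0 < `|a j x - a j e| / 2.
    by rewrite divr_gt0// normr_gt0 subr_eq0.
  have [k _ kr] := near_infty_natSinv_lt (PosNum r0).
  pose m := maxn j.+1 k.
  have [d [_ dx] ed] := e_near (a j) _ _ (ex_intro2 _ _ m Logic.I (fun d h => h)) r0.
  have jm : (j < m)%N by rewrite leq_max ltnSn.
  have {}dx : `|a j d - a j x| < m.+1%:R^-1 := dx (Ordinal jm).
  have mr : m.+1%:R^-1 < `|a j x - a j e| / 2 := kr m (leq_maxr _ _).
  have := ler_normD (a j x - a j d) (a j d - a j e).
  rewrite addrA subrK (distrC (a j x) (a j d)) (distrC (a j d) (a j e)) leNgt => /negP[].
  by rewrite [ltRHS]splitr; apply: ltrD => //; exact: lt_trans mr.
exists (quotient_pi annihilator @` rational_span D).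
  by apply: sub_countable (card_image_le _ _) _; exact: countable_rational_span.
move=> O [z Oz] O_open; have [x xz] := quotient_piK z.
have /nbhs_ballP[r /= r0 rO] := open_nbhs_nbhs (conj O_open Oz).
pose W : set X := [set x | exists2 e, e \in subspace_pred E &
  quotient_pi annihilator x = quotient_pi annihilator e].
have span_W y : linear_span K y -> W y.
  move=> [n [c [v [Kv ->]]]].
  elim/big_ind : _ => [|u w [u' u'E uu'] [w' w'E ww']|i _].
  - by exists 0; [exact: rpred0|].
  - by exists (u' + w'); [exact: rpredD|rewrite !quotient_piD uu' ww'].
  - have [e eE ve] := KE _ (Kv i); exists (c i *: e); first exact: rpredZ.
    by rewrite -!quotient_piZ ve.
have x_cl : closure (linear_span K) x by rewrite K_dense.
have r2 : 0 < r / 2 by rewrite divr_gt0.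
have /closure_ballP/(_ _ r2)[y /span_W[e eE ye] xy] := x_cl.
move: eE => /asboolP/closure_ballP/(_ _ r2)[c c_span ec].
exists (quotient_pi annihilator c); split; last by exists c.
apply: rO; rewrite -ball_normE /= -xz.
have -> : quotient_pi annihilator x - quotient_pi annihilator c =
    quotient_pi annihilator (x - y) + quotient_pi annihilator (e - c).
  by rewrite !quotient_piB ye addrA subrK.
apply: le_lt_trans (ler_normD _ _) _; rewrite [r]splitr ltrD//.
  exact: le_lt_trans (quotient_pi_le _ _) xy.
exact: le_lt_trans (quotient_pi_le _ _) ec.
Qed.

End Annihilator.

(** * Transfer of the Szlenk derivations to a quotient *)

Section SzlenkQuotient.
Variables (R : realType) (X : normedModType R) (K : set X) (e : R).
Hypotheses (K_cpt : compact (K : set (weak X))).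
Hypotheses (K_dense : closure (linear_span K) = [set: X]).

(** A functional on the quotient and the one that it induces on X have different
    types, hence a relation instead of an equation. *)
Definition lifts (Y : closed_subspace X) (f : dual_space X)
    (u : dual_space (quotient_space Y)) :=
  forall x, u (quotient_pi Y x) = f x.

Definition vanishes_on (Y : closed_subspace X) (A : set (dual_space X)) :=
  forall f, A f -> forall y, y \in subspace_pred Y -> f y = 0.

(** The set G consists of f and of the members of a countable family of pairs
    clustering at (f, f).  The set L' stands for any subset of the dual of X/Y that
    contains the lifts of G: in the transfinite induction it is the iterate in the
    dual of the quotient, which is not determined by L. *)
Lemma szlenk_derivation_countable (L : set (weak_star X)) (f : dual_space X) :
  L `<=` @dual_ball R X -> szlenk_derivation e L f ->
  exists G : set (dual_space X), [/\ countable G, G `<=` L &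
    forall (Y : closed_subspace X) (L' : set (weak_star (quotient_space Y))),
      vanishes_on Y G ->
      (forall g u, G g -> @lifts Y g u -> L' u) ->
      forall u, lifts f u -> szlenk_derivation e L' u].
Proof.
move=> L_ball /szlenk_derivationP[Lf Lpair].
pose S : set (dual_space X * dual_space X) :=
  [set p | [/\ L p.1, L p.2 & e < opnorm (fun x => p.1 x - p.2 x)]].
have [|p [Lp1 Lp2 _]|U U_open Uf|A [F [A_cnt AS F_proper FA F_small]]] :=
  @pairs_cluster_countable R X f K S K_cpt K_dense.
- exact: L_ball.
- by split; exact: L_ball.
- by have [g [h [Lg Lh Ug Uh gh]]] := Lpair U U_open Uf; exists (g, h).
exists ([set f] `|` (fst @` A `|` snd @` A)); split.
- do 2?apply: countable_setU => //.
    exact: sub_countable (card_image_le _ _) A_cnt.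
  exact: sub_countable (card_image_le _ _) A_cnt.
- by move=> g [->//|[[p /AS[Lp1 Lp2 _] <-]|[p /AS[Lp1 Lp2 _] <-]]].
move=> Y L' GY L'lift u uf.
(* l g is a lift of g when there is one, and u as a default otherwise *)
have /choice[l lE] (g : dual_space X) : exists v : dual_space (quotient_space Y),
    (forall y, y \in subspace_pred Y -> g y = 0) -> lifts g v.
  have [gY|gnY] := pselect (forall y, y \in subspace_pred Y -> g y = 0).
    by have [v vg] := dual_descend gY; exists v.
  by exists u.
have l1 p : A p -> lifts p.1 (l p.1).
  by move=> Ap; apply: lE; apply: GY; right; left; exists p.
have l2 p : A p -> lifts p.2 (l p.2).
  by move=> Ap; apply: lE; apply: GY; right; right; exists p.
apply/szlenk_derivationP; split; first by apply: (L'lift f) => //; left.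
move=> U U_open Uu.
have near1 : \forall p \near F, U (l p.1).
  apply: (@weak_star_near _ _ _ F (fun p => l p.1) u) => // z d d0.
  have [x <-] := quotient_piK z; near=> p.
  rewrite l1 ?uf; last by near: p.
  have : pair_error f p x < d by near: p; exact: F_small.
  by apply: le_lt_trans; rewrite /pair_error lerDl.
have near2 : \forall p \near F, U (l p.2).
  apply: (@weak_star_near _ _ _ F (fun p => l p.2) u) => // z d d0.
  have [x <-] := quotient_piK z; near=> p.
  rewrite l2 ?uf; last by near: p.
  have : pair_error f p x < d by near: p; exact: F_small.
  by apply: le_lt_trans; rewrite /pair_error lerDr.
have [p [Ap [Up1 Up2]]] := filter_ex (filterI FA (filterI near1 near2)).
have [_ _ p_gt] := AS p Ap.
exists (l p.1), (l p.2); split=> //.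
- by apply: (L'lift p.1); [right; left; exists p|exact: l1].
- by apply: (L'lift p.2); [right; right; exists p|exact: l2].
rewrite -(@quotient_opnorm _ _ _ _ (opnorm (l p.1) + opnorm (l p.2))).
- rewrite (_ : _ \o _ = fun x => p.1 x - p.2 x)//.
  by apply/funext => x /=; rewrite l1// l2.
- move=> t z.
  have lZ (v : dual_space (quotient_space Y)) : v (t *: z) = t * v z by exact: linearZ.
  by rewrite !lZ mulrBr.
- move=> z; rewrite mulrDl; apply: le_trans (ler_normB _ _) _.
  by apply: lerD; exact: dual_bound.
Unshelve. all: by end_near.
Qed.

Lemma lifts_dual_ball Y f u : @dual_ball R X f -> @lifts Y f u -> @dual_ball R (quotient_space Y) u.
Proof.
move=> f1 uf; rewrite /dual_ball /=.
rewrite -(@quotient_opnorm _ _ Y u (opnorm u)); last exact: dual_bound.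
  by rewrite (_ : _ \o _ = f)//; apply/funext => x /=; exact: uf.
by move=> t z; exact: linearZ.
Qed.

Lemma countable_ord_lt a b : countable_ord a -> olt b a -> countable_ord b.
Proof.
move=> [h ha] ba; exists h => c cb; apply: ha.
exact: olt_le_trans cb (oltW ba).
Qed.

(** Well-founded induction on the ordinal.  For each of the countably many smaller
    ordinals b, the one-step transfer yields a countable set, and
    the induction hypothesis at b yields a countable set for each of its members. *)
Lemma szlenk_iter_countable a f : countable_ord a ->
  szlenk_iter e (@dual_ball R X) a f ->
  exists2 G : set (dual_space X), countable G &
    forall Y, vanishes_on Y G -> forall u, @lifts Y f u ->
      szlenk_iter e (@dual_ball R (quotient_space Y)) a u.
Proof.
elim/(well_founded_ind olt_wf) : a f => a IH f a_cnt af.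
have [h ha] := a_cnt.
have step n : exists G : set (dual_space X), countable G /\ (olt (h n) a ->
    forall Y, vanishes_on Y G -> forall u, @lifts Y f u ->
      szlenk_derivation e (szlenk_iter e (@dual_ball R (quotient_space Y)) (h n)) u).
  have [ha_lt|hna] := pselect (olt (h n) a); last by exists set0; split.
  have f_der : szlenk_derivation e (szlenk_iter e (@dual_ball R X) (h n)) f.
    rewrite -szlenk_iterS; apply: szlenk_iter_le af.
    by case: (a) ha_lt => J k kn _.
  have [G [G_cnt GL G_der]] := szlenk_derivation_countable
    (@szlenk_iter_sub R X e (@dual_ball R X) (h n)) f_der.
  have /choice[B BE] (g : dual_space X) : exists B : set (dual_space X), G g -> countable B /\
      forall Y, vanishes_on Y B -> forall u, @lifts Y g u ->
        szlenk_iter e (@dual_ball R (quotient_space Y)) (h n) u.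
    have [Gg|nGg] := pselect (G g); last by exists set0.
    have [B B_cnt B_iter] := IH _ ha_lt g (countable_ord_lt a_cnt ha_lt) (GL g Gg).
    by exists B => _; split.
  exists (G `|` \bigcup_(g in G) B g); split.
    apply: countable_setU => //; apply: bigcup_countable => // g Gg.
    by have [] := BE g Gg.
  move=> _ Y Y_van u uf; apply: (G_der Y) uf => [g Gg|g v Gg vg].
    by apply: Y_van; left.
  have [_ B_iter] := BE g Gg; apply: B_iter vg => k Bk.
  by apply: Y_van; right; exists g.
have [G GE] := choice step.
exists (\bigcup_n G n).
  by apply: bigcup_countable => // n _; have [] := GE n.
move=> Y Y_van u uf.
have u_ball : @dual_ball R (quotient_space Y) u.
  by apply: lifts_dual_ball uf; exact: szlenk_iter_sub af.
case: a {IH a_cnt af} ha step GE => J k ha step GE; split=> // j _.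
have [n [kn nk]] := ha (k j) (olt_sub k j).
rewrite (szlenk_iter_oeq _ _ (conj kn nk)).
have [_ G_der] := GE n; apply: G_der uf.
  exact: ole_lt_trans nk (olt_sub k j).
by move=> g Gg; apply: Y_van; exists n.
Qed.

End SzlenkQuotient.

(** The iterates decrease, so the supremum over e exceeds a exactly when, for some
    e, the iterate at a has not yet vanished. *)
Lemma szlenk_gtP (R : realType) (X : normedModType R) (a : Ord) :
  eolt (Some a) (szlenk X) <->
  exists2 e : R, 0 < e & szlenk_iter e (@dual_ball R X) a !=set0.
Proof.
have eps_le e b : eole (szlenk_eps (@dual_ball R X) e) (Some b) <->
    szlenk_iter e (@dual_ball R X) b = set0.
  rewrite /szlenk_eps.
  have := ominP (fun a => szlenk_iter e (@dual_ball R X) a = set0).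
  case: omin => [c [c0 c_min]|none]; split => //=.
  - by move=> /szlenk_iter_le cb; apply/seteqP; split=> // x /cb; rewrite c0.
  - exact: c_min.
  - by move=> /none.
rewrite /szlenk /eosup; set P := fun b => _.
have PE b : P b <-> forall e : R, 0 < e -> szlenk_iter e (@dual_ball R X) b = set0.
  split=> [Pb e e0|b0 _ [e e0 ->]]; last exact/eps_le/b0.
  by apply/eps_le/Pb; exists e.
have := ominP P; case: omin => [c [/PE Pc c_min]|none] /=; split.
- move=> ac; apply: contrapT => noe; apply: (iffLR (oleNlt c a)) => //.
  apply: c_min; apply/PE => e e0; apply: contrapT => /eqP/set0P ne.
  by apply: noe; exists e.
- move=> [e e0 [x ax]]; apply: contrapT => /oleNlt ca.
  by have := szlenk_iter_le ca ax; rewrite Pc.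
- move=> _; apply: contrapT => noe; apply: (none a).
  apply/PE => e e0; apply: contrapT => /eqP/set0P ne.
  by apply: noe; exists e.
- by [].
Qed.

Theorem mainTheorem11 (R : realType) (X : completeNormedModType R) (alpha : Ord) :
  WCG X -> countable_ord alpha ->
  eolt (Some alpha) (szlenk X) ->
  exists Y : closed_subspace X,
    separable (quotient_space Y) /\ eolt (Some alpha) (szlenk (quotient_space Y)).
Proof.
move=> [K [K_cpt K_dense]] alpha_cnt /szlenk_gtP[e e0 [f alpha_f]].
have [G G_cnt G_iter] := szlenk_iter_countable K_cpt K_dense alpha_cnt alpha_f.
pose A := [set f : dual_space X] `|` G.
have AE : countable A by apply: countable_setU.
exists (annihilator A); split.
  exact: separable_annihilator_quotient K_cpt K_dense AE.
have A_van : vanishes_on (annihilator A) A.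
  by move=> g Ag y /in_annihilator; apply.
have [u uf] : exists u, @lifts R X (annihilator A) f u.
  by apply: dual_descend => y; apply: A_van; left.
apply/szlenk_gtP; exists e => //; exists u; apply: G_iter uf => g Gg.
by apply: A_van; right.
Qed.
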